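(* Let $p\ge r>0$ be positive integers and let $q,s\in\mathbb{Z}$. Define $(p_1,q_1,r_1,s_1)=(p,[q]_p,r,[s]_r)$, and let $\{(p_i,q_i,r_i,s_i)\}_{i=1}^{n}$ be the sequence of quadruples obtained by the following recursive procedure: if $q_i=0$ or $s_i=0$, let $n=i$ and stop; otherwise, \[ (p_{i+1},q_{i+1},r_{i+1},s_{i+1}):=\begin{cases}(q_i,\,[p_i]_{q_i},\,r_i,\,[-s_i]_{r_i}) & \text{if } q_i\ge r_i,\\ (r_i,\,[s_i+q_i]_{r_i},\,q_i,\,[r_i-p_i]_{q_i}) & \text{if } q_i<r_i.\end{cases} \] Then the sequence $\{(p_i,q_i,r_i,s_i)\}_{i=1}^{n}$ is finite (the procedure terminates), $NC(p,q;r,s)=NC(p_i,q_i;r_i,s_i)$ for each $i=1,\dots,n$, and \[ NC(p,q;r,s)=\begin{cases} p_n-r_n+\gcd(r_n,s_n) & \text{if } q_n=0,\\ \gcd(p_n,q_n) & \text{if } s_n=0.\end{cases} \]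
   Context: For positive integers $p\ge r>0$ and integers $q,s$, the twisted torus link $T(p,q;r,s)$ is the closure of the braid on $p$ strands $(\sigma_1\sigma_2\cdots\sigma_{p-1})^q(\sigma_1\cdots\sigma_{r-1})^s$, where $\sigma_1,\dots,\sigma_{p-1}$ are the standard generators of the braid group on $p$ strands (an empty product is the trivial braid). $NC(p,q;r,s)$ denotes the number of components of the link $T(p,q;r,s)$. For an integer $x$ and a positive integer $m$, $[x]_m\in\{0,1,\dots,m-1\}$ denotes the residue of $x$ modulo $m$. By convention $\gcd(a,0)=|a|$. *)

(* Defs.v *)
From mathcomp Require Import all_boot all_order all_algebra finmap.
From mathcomp Require Import all_classical all_reals all_analysis.
Import numFieldNormedType.Exports.

Set Implicit Arguments.
Unset Strict Implicit.
Unset Printing Implicit Defensive.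

Import Order.TTheory GRing.Theory Num.Theory.
Local Open Scope classical_set_scope.
Local Open Scope ring_scope.

(** Braids are given by words in the standard generators: the letter (j, true)
    is sigma_j and (j, false) is sigma_j^-1.  On p strands, 1 <= j <= p - 1. *)
Definition braid_word := seq (nat * bool).

Definition braid_inv (w : braid_word) : braid_word :=
  rev [seq (l.1, ~~ l.2) | l <- w].

Definition braid_exp (w : braid_word) (n : int) : braid_word :=
  match n with
  | Posz m => flatten (nseq m w)
  | Negz m => flatten (nseq m.+1 (braid_inv w))
  end.

(** sigma_1 sigma_2 ... sigma_(m-1) *)
Definition sigma_upto (m : nat) : braid_word :=
  [seq (j, true) | j <- iota 1 m.-1].

Definition twisted_torus_braid (p : nat) (q : int) (r : nat) (s : int)
    : braid_word :=
  braid_exp (sigma_upto p) q ++ braid_exp (sigma_upto r) s.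

(** The position reached through sigma_j or its inverse from position i. *)
Definition crossing_target (j i : nat) : nat :=
  if i == j then j.+1 else if i == j.+1 then j else i.

Section ClosedBraid.
Variable R : realType.

(** Points are (x, y, z).  Strands run upwards along z, at the positions
    x = 1, ..., p of the plane y = 0, and y separates the two strands of a
    crossing.  The k-th letter (k = 0, 1, ...) occupies k <= z <= k + 1. *)
Local Notation space := (R * R * R)%type.

(** The arc of the letter l that starts at (i, 0, k).  In a crossing b - a is
    1 for the strand going from j to j + 1 and -1 for the other one, so that
    they pass on opposite sides of the plane y = 0, exchanged for the inverse
    generator; every other strand has a = b and is vertical. *)
Definition braid_arc (k : nat) (l : nat * bool) (i : nat) : set space :=
  let a : R := i%:R in
  let b : R := (crossing_target l.1 i)%:R in
  [set (line_path a b t,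
        (-1) ^+ (~~ l.2) * (b - a) * (t * (1 - t)),
        k%:R + t) | t in `[0, 1]].

Definition segment (u v : space) : set space :=
  [set (line_path u.1.1 v.1.1 t,
        line_path u.1.2 v.1.2 t,
        line_path u.2 v.2 t) | t in `[0, 1]].

Fixpoint polygonal_path (u : space) (vs : seq space) : set space :=
  if vs is v :: vs' then segment u v `|` polygonal_path v vs' else set0.

(** The arc joining the top endpoint (i, 0, L) of a braid of height L to its
    bottom endpoint (i, 0, 0), around the y-axis; for distinct i they are
    nested in the plane y = 0. *)
Definition closing_arc (L i : nat) : set space :=
  let x : R := i%:R in
  let top : R := (L + i)%:R in
  polygonal_path (x, 0, L%:R)
    [:: (x, 0, top); (- x, 0, top); (- x, 0, - x); (x, 0, - x); (x, 0, 0)].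

(** The closure, in 3-space, of the braid w on p strands. *)
Definition braid_closure (p : nat) (w : braid_word) : set space :=
  [set v | exists i : nat, (1 <= i <= p)%N /\
     (closing_arc (size w) i v \/
      exists2 k : nat, (k < size w)%N & braid_arc k (nth (0%N, true) w k) i v)].

Definition twisted_torus_link (p : nat) (q : int) (r : nat) (s : int)
    : set space :=
  braid_closure p (twisted_torus_braid p q r s).

End ClosedBraid.
Arguments twisted_torus_link : clear implicits.

Definition components (T : topologicalType) (A : set T) : set (set T) :=
  [set connected_component A x | x in A].

(** The number of components of T(p, q; r, s).  [fset_set] sends infinite sets
    to the empty one, but a closed braid has finitely many components, and at
    least one if it has a strand. *)
Definition NC (R : realType) (p : nat) (q : int) (r : nat) (s : int) : nat :=
  #|` fset_set (components (twisted_torus_link R p q r s))|.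

(** The residue of x modulo m > 0, in {0, ..., m - 1}. *)
Definition residue (x : int) (m : nat) : nat := `|(x %% m)%Z|%N.

Record quadruple := Quad { qp : nat; qq : nat; qr : nat; qs : nat }.

Definition stops (a : quadruple) : bool := (qq a == 0%N) || (qs a == 0%N).

(** Meaningful only on quadruples that do not stop, for which the moduli
    q_i and r_i are positive. *)
Definition next_quadruple (a : quadruple) : quadruple :=
  let: Quad p q r s := a in
  if (r <= q)%N then Quad q (residue p q) r (residue (- s%:Z) r)
  else Quad r (residue (s%:Z + q%:Z) r) q (residue (r%:Z - p%:Z) q).

(** The i-th quadruple, numbered from i = 1; it belongs to the sequence as long
    as no earlier one stops. *)
Definition quadruple_at (p : nat) (q : int) (r : nat) (s : int) (i : nat)
    : quadruple :=
  iter i.-1 next_quadruple (Quad p (residue q p) r (residue s r)).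

Definition last_index (p : nat) (q : int) (r : nat) (s : int) (n : nat) : Prop :=
  [/\ (1 <= n)%N,
      stops (quadruple_at p q r s n) &
      forall i, (1 <= i < n)%N -> ~~ stops (quadruple_at p q r s i)].

(* Main.v *)
(** A closed braid is the union of one loop per strand, made of the strand and
    of the closing arc at its bottom.  The loops are connected and closed, each
    one meets the next one along the permutation of the strands, and two loops
    that meet are neighbours in this sense.  So the components of the closure
    correspond to the cycles of the permutation, and NC(p, q; r, s) is the
    number of cycles of the rotation by -q of Z/p followed by the rotation by -s
    of its first r elements.  The recursive step replaces this permutation by
    its first return map to the first max(q, r) elements: up to conjugation and
    inversion it is again a composition of two such rotations, with the
    parameters of the next quadruple.  The sum p + r decreases at each step.
    For s = 0 the same step is Euclid's algorithm, and for q = 0 the points from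
    r on are fixed. *)

Require Import Defs.
From mathcomp Require Import all_boot all_order all_algebra finmap.
From mathcomp Require Import all_classical all_reals all_analysis.
From mathcomp Require Import zify lra.
Import numFieldNormedType.Exports.

Set Implicit Arguments.
Unset Strict Implicit.
Unset Printing Implicit Defensive.

Import Order.TTheory GRing.Theory Num.Theory.
Local Open Scope nat_scope.

(** * Cycles of permutations of an initial segment *)

(** [r] and [h] induce mutually inverse maps between the orbits of [f] and those of [g]: each
    respects a single step, and a round trip stays in its orbit. *)
Lemma fcard_adjunction (T T' : finType) (f : T -> T) (g : T' -> T')
    (h : T' -> T) (r : T -> T') :
    injective f -> injective g ->
    (forall x, fconnect f x (h (r x))) ->
    (forall x, fconnect g (r x) (r (f x))) ->
    (forall y, fconnect g y (r (h y))) ->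
    (forall y, fconnect f (h y) (h (g y))) ->
  fcard f T = fcard g T'.
Proof.
move=> /fconnect_sym f_sym /fconnect_sym g_sym xhr rf yrh hg.
have cl : fclosed f T by move=> x y _; rewrite !inE.
rewrite (adjunction_n_comp h f_sym g_sym cl); first exact: eq_n_comp_r.
apply: (intro_adjunction g_sym cl (fun x _ => r x)) => [x _ | y _]; split=> //.
- by move=> _ _ /eqP <-.
- by move=> _ /eqP <-.
Qed.

Lemma fcard_comp_comm (T : finType) (f g : T -> T) :
  injective f -> injective g -> fcard (f \o g) T = fcard (g \o f) T.
Proof.
move=> f_inj g_inj.
apply: (@fcard_adjunction _ _ _ _ f g) => [||x|x|x|x].
1,2: exact: inj_comp.
- exact: (fconnect1 (f \o g)).
- exact: (fconnect1 (g \o f)).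
- exact: (fconnect1 (g \o f)).
- exact: (fconnect1 (f \o g)).
Qed.

(** Maps live on [nat], so that composing them and changing the bound [p] needs no casts between
    ordinals. *)
Definition perm_below p (f : nat -> nat) :=
  (forall x, x < p -> f x < p) /\
  (forall x y, x < p -> y < p -> f x = f y -> x = y).

(** The default [i] makes this total; under [perm_below p f] the value is [f i]. *)
Definition restr p (f : nat -> nat) (i : 'I_p) : 'I_p := insubd i (f i).

Definition ncycles p f := fcard (@restr p f) 'I_p.

Section Restriction.
Variables (p : nat) (f : nat -> nat).
Hypothesis fP : perm_below p f.

Lemma val_restr (i : 'I_p) : restr f i = f i :> nat.
Proof. by rewrite val_insubd; case: fP => -> //. Qed.

Lemma restr_inj : injective (@restr p f).
Proof.
case: fP => _ f_inj i j /(congr1 (@nat_of_ord p)).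
by rewrite !val_restr => /f_inj e; apply/val_inj/e.
Qed.

End Restriction.

Lemma perm_below_comp p f g :
  perm_below p f -> perm_below p g -> perm_below p (f \o g).
Proof.
move=> [fp f_inj] [gp g_inj]; split=> [x /gp/fp // | x y xp yp /=].
by move=> /f_inj e; apply: g_inj => //; apply: e; apply: gp.
Qed.

Lemma eq_ncycles p f g :
  (forall x, x < p -> f x = g x) -> ncycles p f = ncycles p g.
Proof.
move=> fg; apply: eq_fcard => i; apply: val_inj.
by rewrite !val_insubd fg.
Qed.

Lemma ncycles_comm p f g : perm_below p f -> perm_below p g ->
  ncycles p (f \o g) = ncycles p (g \o f).
Proof.
move=> fP gP; have := fcard_comp_comm (restr_inj fP) (restr_inj gP).
suff E f' g' : perm_below p f' -> perm_below p g' ->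
   restr f' \o restr g' =1 @restr p (f' \o g').
  by rewrite (eq_fcard (E _ _ fP gP)) (eq_fcard (E _ _ gP fP)).
move=> f'P g'P i; apply: val_inj.
by rewrite /= !val_restr //; apply: perm_below_comp.
Qed.

Lemma ncycles_inv p f g : perm_below p f -> perm_below p g ->
  (forall x, x < p -> g (f x) = x) -> ncycles p g = ncycles p f.
Proof.
move=> fP gP fK; rewrite /ncycles -(fcard_finv (restr_inj fP)).
apply: eq_fcard; apply: fsym; apply: finv_eq_can => i; apply: val_inj.
by rewrite /= !val_restr // fK.
Qed.

(* [ret x] is the first point below [p'] on the forward orbit of [x], so [g] is
   the first return map of [f] to [0, p'). *)
Lemma ncycles_return p p' (f g ret : nat -> nat) :
    perm_below p f -> perm_below p' g -> p' <= p ->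
    (forall x, p' <= x < p -> f x < x /\ ret (f x) = ret x) ->
    (forall x, x < p' -> ret x = x /\ g x = ret (f x)) ->
  ncycles p f = ncycles p' g.
Proof.
move=> fP gP le_p'p above below.
have ret_lt x : x < p -> ret x < p'.
  elim/ltn_ind: x => x IH xp; have [xp' | p'x] := ltnP x p'.
    by have [-> _] := below x xp'.
  have [|fx <-] := above x; first by rewrite p'x.
  exact: IH (ltn_trans fx xp).
pose h := widen_ord le_p'p.
pose r (i : 'I_p) : 'I_p' := Ordinal (ret_lt i (ltn_ord i)).
(* Induction on the size of [i]: above [p'] a step of [f] decreases the point and keeps its
   [ret]. *)
have reach (i : 'I_p) : fconnect (restr f) i (h (r i)).
  have [n] := ubnP (i : nat); elim: n i => // n IH i /ltnSE lin.
  have [ip' | p'i] := ltnP i p'.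
    rewrite (_ : h _ = i) //; apply: val_inj => /=.
    by have [] := below i ip'.
  have [|fi rfi] := above i; first by rewrite p'i /=.
  apply: connect_trans (fconnect1 _ _) _.
  rewrite (_ : r i = r (restr f i)).
    by apply: IH; rewrite val_restr // (leq_trans fi).
  by apply: val_inj; rewrite /= val_restr.
have step (j : 'I_p') : restr g j = r (restr f (h j)).
  by apply: val_inj; rewrite /= !val_restr //; have [] := below j (ltn_ord j).
apply: (@fcard_adjunction _ _ _ _ h r) => [||//|i|j|j].
- exact: restr_inj.
- exact: restr_inj.
- have [ip' | p'i] := ltnP i p'.
    have -> : restr f i = restr f (h (r i)).
      by congr restr; apply: val_inj; have [] := below i ip'.
    by rewrite -step; apply: fconnect1.
  rewrite (_ : r (restr f i) = r i) //; apply: val_inj; rewrite /= val_restr //.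
  by have [|_ ->] := above i; first by rewrite p'i /=.
- rewrite (_ : r (h j) = j) //; apply: val_inj => /=.
  by have [] := below j (ltn_ord j).
- by rewrite step; apply: connect_trans (fconnect1 _ _) (reach _).
Qed.

Lemma ncycles_fix p p' f : perm_below p f -> perm_below p' f -> p' <= p ->
  (forall x, p' <= x < p -> f x = x) -> ncycles p f = p - p' + ncycles p' f.
Proof.
move=> fP fP' le_p'p fix_f; pose a := [pred i : 'I_p | i < p'].
have f_sym := fconnect_sym (restr_inj fP).
have f_sym' := fconnect_sym (restr_inj fP').
pose h := widen_ord le_p'p.
have h_inj : injective h by move=> i j /(congr1 val) /= /val_inj.
have fixE (i : 'I_p) : p' <= i -> restr f i = i.
  by move=> p'i; apply: ord_inj; rewrite val_restr // fix_f // p'i /=.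
have cl_a : fclosed (restr f) a.
  move=> i _ /eqP <-; rewrite !inE val_restr //.
  have [ip' | p'i] := ltnP i p'; first by case: fP' => ->.
  by rewrite fix_f ?p'i //= ltnNge p'i.
rewrite /ncycles (n_compC a) addnC; congr (_ + _).
  (* Outside [a] every point is the root of its own cycle. *)
  transitivity #|[predC a]|.
    apply: eq_card => i; rewrite !inE.
    have [// | p'i /=] := ltnP i p'; first by rewrite andbF.
    rewrite andbT; apply/eqP.
    rewrite -[LHS](iter_findex (connect_root (frel (restr f)) i)).
    exact/iter_fix/fixE.
  rewrite -[p in RHS]card_ord -(cardC a) -[p' in RHS](card_ord p').
  have -> : #|a| = #|'I_p'|; last by rewrite addnC addnK.
  rewrite -(card_codom h_inj); apply: eq_card => i; rewrite !inE.
  apply/idP/codomP => [ip' | [j ->]]; last exact: (ltn_ord j).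
  by exists (Ordinal ip'); apply: val_inj.
rewrite (adjunction_n_comp h f_sym f_sym' cl_a).
  by apply: eq_n_comp_r => i; rewrite !inE /= ltn_ord.
apply: (strict_adjunction f_sym' cl_a) => //.
  apply/fintype.subsetP => i; rewrite inE => ip'; apply/codomP.
  by exists (Ordinal ip'); apply: val_inj.
by move=> i j _ /=; rewrite -!val_eqE /= !val_restr.
Qed.

(** * Cycles of twisted torus permutations *)

Lemma residueP (x : int) m : 0 < m ->
  exists2 k : int, (residue x m < m) & (x = (residue x m)%:Z + k * m%:Z)%R.
Proof.
move=> m_gt0; exists (x %/ m)%Z; rewrite /residue; last first.
  by rewrite gez0_abs ?modz_ge0 ?[LHS](divz_eq x m) 1?addrC // -lt0n.
by rewrite -ltz_nat gez0_abs ?modz_ge0 ?ltz_pmod // -lt0n.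
Qed.

Lemma residue_eq (x k : int) m y :
  y < m -> (x = y%:Z + k * m%:Z)%R -> residue x m = y.
Proof. by move=> ym ->; rewrite /residue addrC modzMDl modz_nat modn_small. Qed.

Lemma residue_nat x m : residue x%:Z m = x %% m.
Proof. by rewrite /residue modz_nat. Qed.

(* Positions are numbered from 0 here, and from 1 in braids. *)
Definition rho p (q : int) x := if x < p then residue (x%:Z - q) p else x.

Lemma rhoP p q x : x < p ->
  exists2 k : int, rho p q x < p & (x%:Z - q = (rho p q x)%:Z + k * p%:Z)%R.
Proof.
by move=> xp; rewrite /rho xp; apply: residueP; apply: leq_ltn_trans xp.
Qed.

Lemma rho_id p q x : p <= x -> rho p q x = x.
Proof. by rewrite /rho ltnNge => ->. Qed.

(** An explicit quotient [k] certifies the value and leaves linear goals; below, [0] means no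
    wrap-around and [-1] means that [x - q] is negative. *)
Lemma rho_eq p q x y (k : int) :
  x < p -> y < p -> (x%:Z - q = y%:Z + k * p%:Z)%R -> rho p q x = y.
Proof. by rewrite /rho => ->; apply: residue_eq. Qed.

Lemma rhoD p a b x : rho p a (rho p b x) = rho p (a + b)%R x.
Proof.
have [xp | px] := ltnP x p; last by rewrite !rho_id.
have [k ylt ey] := rhoP b xp; have [l zlt ez] := rhoP a ylt.
by symmetry; apply: (@rho_eq _ _ _ _ (k + l)%R) => //; lia.
Qed.

Lemma rho0 p x : rho p 0 x = x.
Proof.
by rewrite /rho; case: ltnP => // xp; rewrite subr0 residue_nat modn_small.
Qed.

Lemma rhoK p q x : rho p (- q) (rho p q x) = x.
Proof. by rewrite rhoD addNr rho0. Qed.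

Lemma rho_inj p q : injective (rho p q).
Proof. exact: can_inj (@rhoK p q). Qed.

Lemma rho_mod p q x : rho p (residue q p)%:Z x = rho p q x.
Proof.
rewrite /rho; case: ltnP => // xp; have p_gt0 := leq_ltn_trans (leq0n x) xp.
have [k _ ek] := residueP q p_gt0; have [l lt el] := residueP (x%:Z - q) p_gt0.
by apply: (@residue_eq _ (l + k)%R) => //; lia.
Qed.

Lemma rho_below p r q : r <= p -> perm_below p (rho r q).
Proof.
move=> rp; split=> [x xp | x y _ _ /rho_inj //].
have [xr | rx] := ltnP x r; last by rewrite rho_id.
by have [k lt _] := rhoP q xr; apply: leq_trans lt rp.
Qed.

Definition strand_cycles p q r s := ncycles p (rho r s \o rho p q).

Lemma strand_cycles_mod p q r s :
  strand_cycles p (residue q p)%:Z r (residue s r)%:Z = strand_cycles p q r s.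
Proof. by apply: eq_ncycles => x _; rewrite /= !rho_mod. Qed.

(** First return to [[0, q)] of [rho p q \o rho r s]. From [q] on, [rho r s] is the identity and
    each step subtracts [q], so a point returns at its residue modulo [q]; a point [y < q] first
    jumps to [y + p - q]. The return map [rho q (- p) \o rho r s] is the inverse of the permutation
    on the right. *)
Lemma strand_cycles_large_q p q r s : r <= q -> 0 < q < p ->
  strand_cycles p q%:Z r s = strand_cycles q p%:Z r (- s)%R.
Proof.
move=> rq /andP[q_gt0 qp]; have rp := ltnW (leq_ltn_trans rq qp).
rewrite /strand_cycles ncycles_comm; try exact: rho_below.
have gP : perm_below q (rho q (- p%:Z) \o rho r s).
  by apply: perm_below_comp; apply: rho_below.
have hP : perm_below q (rho r (- s) \o rho q p%:Z).
  by apply: perm_below_comp; apply: rho_below.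
rewrite -(@ncycles_inv _ _ _ hP gP) => [|x _]; last first.
  by rewrite /= (rhoD r) addrN rho0 rhoK.
have fP : perm_below p (rho p q%:Z \o rho r s).
  by apply: perm_below_comp; apply: rho_below.
apply: (@ncycles_return _ _ _ _ (fun x => x %% q) fP gP (ltnW qp)).
  move=> x /andP[qx xp] /=; rewrite (rho_id _ (leq_trans rq qx)).
  have -> : rho p q%:Z x = x - q.
    by apply: (@rho_eq _ _ _ _ 0%R); lia.
  by split; [lia | rewrite -[in RHS](subnK qx) modnDr].
move=> x xq; split; first exact: modn_small.
have [/(_ x xq) + _] := rho_below s rq; rewrite /=.
move: (rho r s x) => y yq.
have -> : rho p q%:Z y = y + p - q.
  by apply: (@rho_eq _ _ _ _ (-1)%R); lia.
rewrite /rho yq opprK -PoszD residue_nat.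
by rewrite -[X in X %% _ = _](@subnK q) ?modnDr //; lia.
Qed.

(** First return to [[0, r)] of [rho p q \o rho r s]. After [rho r s], points of [[q, r)] move down
    by [q]; those below [q] wrap around and come back in [[r - q, r)], permuted by the rotation [k]
    of the first [q] points. The return map [rho r q \o k \o rho r s] becomes [k \o rho r (s + q)]
    after a cyclic exchange of factors. *)
Lemma strand_cycles_small_q p q r s : q < r -> 0 < q -> r <= p ->
  strand_cycles p q%:Z r s = strand_cycles r (s + q%:Z)%R q (r%:Z - p%:Z)%R.
Proof.
move=> qr q_gt0 rp; have qp := leq_trans qr rp.
rewrite /strand_cycles ncycles_comm; try exact: rho_below.
pose k := rho q (r%:Z - p%:Z).
have kP : perm_below r (k \o rho r s).
  by apply: perm_below_comp; apply: rho_below; rewrite // ltnW.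
have qP : perm_below r (rho r q%:Z) by apply: rho_below.
have gP := perm_below_comp qP kP.
have fP : perm_below p (rho p q%:Z \o rho r s).
  by apply: perm_below_comp; apply: rho_below.
transitivity (ncycles r (rho r q%:Z \o (k \o rho r s))); last first.
  by rewrite (ncycles_comm qP kP); apply: eq_ncycles => x _; rewrite /= rhoD.
(* Subtracting [q] from [x >= r] until it drops below [r] ends in the window [[r - q, r)]. *)
pose ret x := if x < r then x else r - q + (x - r) %% q.
apply: (@ncycles_return _ _ _ _ ret fP gP rp) => [x /andP[rx xp] | x xr] /=.
  have -> : rho r s x = x by apply: rho_id.
  have -> : rho p q%:Z x = x - q.
    by apply: (@rho_eq _ _ _ _ 0%R); lia.
  split; first lia.
  rewrite /ret [x < r]ltnNge rx /=; case: ltnP => xqr.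
    by rewrite modn_small; lia.
  by rewrite -[in RHS](@subnK q (x - r)) ?modnDr; [congr (_ + _ %% _) |]; lia.
split; first by rewrite /ret xr.
have [/(_ x xr) + _] := rho_below s (leqnn r); rewrite /=.
move: (rho r s x) => y yr.
have [yq | qy] := ltnP y q; last first.
  have -> : k y = y by apply: rho_id.
  have -> : rho p q%:Z y = y - q.
    by apply: (@rho_eq _ _ _ _ 0%R); lia.
  have -> : rho r q%:Z y = y - q.
    by apply: (@rho_eq _ _ _ _ 0%R); lia.
  by rewrite /ret ifT //; lia.
have -> : rho p q%:Z y = y + p - q.
  by apply: (@rho_eq _ _ _ _ (-1)%R); lia.
have -> : k y = (y + (p - r)) %% q.
  by rewrite /k /rho yq -residue_nat; congr residue; lia.
set z := (y + (p - r)) %% q; have zq : z < q by rewrite ltn_mod.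
have -> : rho r q%:Z z = r - q + z.
  by apply: (@rho_eq _ _ _ _ (-1)%R); lia.
(* If the jump already lands below [r], then [y + (p - r) < q] and the residue changes nothing. *)
rewrite /ret; case: ltnP => yp.
  by rewrite /z modn_small; lia.
congr (_ + _); rewrite /z -[y + (p - r)](@subnK q) ?modnDr; last lia.
by congr (_ %% _); lia.
Qed.

(** The remaining rotation of [r] points is written with last parameter [0], the form evaluated as a
    gcd next. *)
Lemma strand_cycles_q0 p r s : r <= p ->
  strand_cycles p 0 r s = p - r + strand_cycles r s r 0.
Proof.
move=> rp; rewrite /strand_cycles.
transitivity (ncycles p (rho r s)).
  by apply: eq_ncycles => x _; rewrite /= rho0.
rewrite (@ncycles_fix _ r); first last.
- by move=> x /andP[rx _]; rewrite /rho ltnNge rx.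
- by [].
- exact: rho_below.
- exact: rho_below.
by congr addn; apply: eq_ncycles => x _; rewrite /= rho0.
Qed.

Lemma strand_cycles_s0 p q r : 0 < p -> strand_cycles p q%:Z r 0 = gcdn p q.
Proof.
have [n] := ubnP p; elim: n p q r => // n IH p q r /ltnSE pn p_gt0.
(* Rotations by [0] are the identity, so [r] may be replaced by [1], which ensures [r <= q] for the
   Euclidean step. *)
transitivity (strand_cycles p (q %% p)%:Z 1 0).
  apply: eq_ncycles => x _; rewrite /= !rho0 -residue_nat.
  by rewrite -rho_mod.
have lt_qp : q %% p < p by rewrite ltn_mod.
rewrite gcdnC -gcdn_modl; have [-> | q_gt0] := posnP (q %% p).
  rewrite gcd0n -[RHS]card_ord -fcard_id; apply: eq_fcard => i; apply: ord_inj.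
  by rewrite val_insubd /= !rho0 ltn_ord.
rewrite strand_cycles_large_q ?q_gt0 // oppr0 IH //; exact: leq_trans lt_qp pn.
Qed.

(** * The recursion on quadruples: invariant and termination *)

Definition cycles_quad a := strand_cycles (qp a) (qq a)%:Z (qr a) (qs a)%:Z.

Definition reduced a := [&& 0 < qr a, qr a <= qp a, qq a < qp a & qs a < qr a].

(** In both cases the new sum is [q + r], smaller than [p + r] because [q < p]. *)
Lemma next_quadrupleP a : reduced a -> ~~ stops a ->
  [/\ reduced (next_quadruple a),
      cycles_quad (next_quadruple a) = cycles_quad a &
      qp (next_quadruple a) + qr (next_quadruple a) < qp a + qr a].
Proof.
case: a => p q r s; rewrite /reduced /stops /cycles_quad /= negb_or -!lt0n.
case/and4P=> r_gt0 rp qp sr /andP[q_gt0 s_gt0].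
have res_lt x m : 0 < m -> residue x m < m by move=> /(residueP x)[].
case: (leqP r q) => rq /=; rewrite strand_cycles_mod.
  split; [by rewrite r_gt0 rq !res_lt | | lia].
  by rewrite (@strand_cycles_large_q p) ?q_gt0.
split; [by rewrite q_gt0 (ltnW rq) !res_lt | | lia].
by rewrite (@strand_cycles_small_q p).
Qed.

Lemma quadruples_stop a :
  reduced a -> exists n, stops (iter n next_quadruple a).
Proof.
have [m] := ubnP (qp a + qr a); elim: m a => // m IH a /ltnSE am red_a.
have [stop_a | go_a] := boolP (stops a); first by exists 0.
have [red_b _ lt_ba] := next_quadrupleP red_a go_a.
have [n stop_n] := IH _ (leq_trans lt_ba am) red_b.
by exists n.+1; rewrite iterSr.
Qed.

Lemma cycles_quad_iter a n : reduced a ->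
    (forall i, i < n -> ~~ stops (iter i next_quadruple a)) ->
  reduced (iter n next_quadruple a) /\
  cycles_quad (iter n next_quadruple a) = cycles_quad a.
Proof.
move=> red_a; elim: n => // n IH go; have [i /ltnW/go // | red_n eq_n] := IH.
by have [] := next_quadrupleP red_n (go n (ltnSn n)); rewrite eq_n.
Qed.

Lemma cycles_quad_stop a : reduced a ->
  (qq a = 0 -> cycles_quad a = qp a - qr a + gcdn (qr a) (qs a)) /\
  (qs a = 0 -> cycles_quad a = gcdn (qp a) (qq a)).
Proof.
case: a => p q r s /and4P[/= r_gt0 rp _ _]; rewrite /cycles_quad /=.
split=> ->; first by rewrite strand_cycles_q0 // strand_cycles_s0.
by rewrite strand_cycles_s0 // (leq_trans r_gt0).
Qed.

(** * The permutation of a braid *)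

Definition strand_end (w : braid_word) i :=
  foldl (fun i l => crossing_target l.1 i) i w.

Lemma crossing_targetK j : involutive (crossing_target j).
Proof. by move=> i; rewrite /crossing_target; do !case: eqP; lia. Qed.

Lemma strand_end_cat v w i :
  strand_end (v ++ w) i = strand_end w (strand_end v i).
Proof. exact: foldl_cat. Qed.

Lemma strand_end_inv w : cancel (strand_end w) (strand_end (braid_inv w)).
Proof.
rewrite /braid_inv; elim: w => //= l w IH i.
rewrite rev_cons -cats1 strand_end_cat /=.
by rewrite IH crossing_targetK.
Qed.


Lemma sigma_uptoS m : sigma_upto m.+2 = rcons (sigma_upto m.+1) (m.+1, true).
Proof. by rewrite /sigma_upto -[m.+2.-1]addn1 iotaD map_cat cats1 add1n. Qed.

(** The strand from position 1 takes part in every crossing and ends at [m]; each other one is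
    crossed once and moves down by one. *)
Lemma strand_end_sigma m i : strand_end (sigma_upto m) i =
  if 1 < i <= m then i.-1 else if (i == 1) && (0 < m) then m else i.
Proof.
case: m => [|m]; first by rewrite /=; case: i => [|[]].
elim: m i => [|m IH] i; first by rewrite /=; case: i => [|[|[]]].
rewrite sigma_uptoS -cats1 strand_end_cat IH /= /crossing_target.
by do !case: ifP; lia.
Qed.

Lemma strand_end_sigma_rho m x :
  strand_end (sigma_upto m) x.+1 = (rho m 1 x).+1.
Proof.
rewrite strand_end_sigma; have [mx | xm] := leqP m x.
  by rewrite rho_id //; do !case: ifP; lia.
have [-> | x_gt0] := posnP x.
  by rewrite (@rho_eq _ _ _ m.-1 (-1)%R); do ?case: ifP; lia.
by rewrite (@rho_eq _ _ _ x.-1 0%R); do ?case: ifP; lia.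
Qed.

Lemma strand_end_sigma_inv m x :
  strand_end (braid_inv (sigma_upto m)) x.+1 = (rho m (-1) x).+1.
Proof.
by rewrite -{1}[x](rhoK m (-1)) opprK -strand_end_sigma_rho strand_end_inv.
Qed.

Lemma strand_end_exp m n x :
  strand_end (braid_exp (sigma_upto m) n) x.+1 = (rho m n x).+1.
Proof.
(* Used with [a = 1] for [Posz], and with [a = -1] and [k.+1] copies for [Negz k]. *)
have pow w a k : (forall y, strand_end w y.+1 = (rho m a y).+1) ->
    forall y, strand_end (flatten (nseq k w)) y.+1 = (rho m (a *+ k)%R y).+1.
  move=> wa; elim: k => [|k IH] y; first by rewrite rho0.
  by rewrite /= strand_end_cat wa IH rhoD mulrS addrC.
case: n => k.
  by rewrite (pow _ _ _ (@strand_end_sigma_rho m)) -natz.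
by rewrite /= (pow _ _ k.+1 (@strand_end_sigma_inv m)) mulNrn NegzE -natz.
Qed.

Lemma strand_end_twisted_torus p q r s x :
  strand_end (twisted_torus_braid p q r s) x.+1 = (rho r s (rho p q x)).+1.
Proof. by rewrite strand_end_cat !strand_end_exp. Qed.

Lemma twisted_torus_letters p q r s : r <= p ->
  all (fun l => 0 < l.1 < p) (twisted_torus_braid p q r s).
Proof.
move=> rp; rewrite all_cat.
have sigma m : m <= p -> all (fun l : nat * bool => 0 < l.1 < p) (sigma_upto m).
  by move=> mp; apply/allP=> l /mapP[j]; rewrite mem_iota => j_lt -> /=; lia.
have exp w n : all (fun l : nat * bool => 0 < l.1 < p) w ->
    all (fun l => 0 < l.1 < p) (braid_exp w n).
  have pow v k : all (fun l : nat * bool => 0 < l.1 < p) v ->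
      all (fun l => 0 < l.1 < p) (flatten (nseq k v)).
    by move=> v_ok; elim: k => //= k IH; rewrite all_cat v_ok.
  move=> w_ok; case: n => k; apply: pow => //.
  by rewrite all_rev all_map.
by rewrite !exp // ?sigma.
Qed.

Lemma strand_end_invr w : cancel (strand_end (braid_inv w)) (strand_end w).
Proof.
rewrite /braid_inv; elim: w => //= l w IH i.
rewrite rev_cons -cats1 strand_end_cat /=.
by rewrite crossing_targetK IH.
Qed.

Lemma strand_end_bounds p w i : all (fun l => 0 < l.1 < p) w ->
  1 <= i <= p -> 1 <= strand_end w i <= p.
Proof.
elim: w i => //= l w IH i /andP[l_ok w_ok] i_ok; apply: IH => //.
by rewrite /crossing_target; do !case: eqP; lia.
Qed.

Lemma braid_inv_letters (P : pred nat) w : all (fun l => P l.1) w ->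
  all (fun l => P l.1) (braid_inv w).
Proof. by rewrite all_rev all_map. Qed.

Lemma strand_end_takeS w k i : k < size w ->
  strand_end (take k.+1 w) i =
  crossing_target (nth (0, true) w k).1 (strand_end (take k w) i).
Proof. by move=> kw; rewrite (take_nth (0, true)) // -cats1 strand_end_cat. Qed.

(** * Components of a closed braid *)

Local Open Scope ring_scope.
Local Open Scope classical_set_scope.

(** The components are the unions [U i] of the sets along an orbit: consecutive sets meet, so [U i]
    is connected, and unions over different orbits are disjoint and closed. *)
Lemma components_bigcup (T : topologicalType) (I : finType) (S : I -> set T)
    (f : I -> I) :
    injective f ->
    (forall i, connected (S i)) -> (forall i, closed (S i)) ->
    (forall i, S i `&` S (f i) !=set0) ->
    (forall i j, S i `&` S j !=set0 -> fconnect f i j) ->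
  #|` fset_set (components (\bigcup_i S i))| = fcard f I.
Proof.
move=> f_inj S_conn S_closed S_link S_meet; set A := \bigcup_i S i.
have f_sym := fconnect_sym f_inj.
pose U i := \bigcup_(j in [set j | fconnect f i j]) S j.
have componentE i x : S i x -> connected_component A x = U i.
  move=> Six; apply/seteqP; split=> [y [C [Cx CA C_conn] Cy] | y [j /= ij Sjy]].
    (* [U i] and the union of the other orbits are finite unions of closed sets, disjoint and
       covering [C]; hence [U i] cuts [C] in a relatively open and closed set. *)
    have [] : (C `&` U i) y; last by [].
    rewrite (_ : C `&` U i = C) //; apply: C_conn.
    - by exists x; split=> //; exists i => //=; apply: connect0.
    - exists (~` \bigcup_(j in [set j | ~~ fconnect f i j]) S j).
        by apply/closed_openC/closed_bigcup => //; apply: finite_finset.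
      apply/seteqP; split=> [z [Cz [j /= ij Sjz]] | z [Cz /= nz]]; split=> //.
        move=> [k /= /negP nik Skz]; apply: nik; apply: connect_trans ij _.
        by apply: S_meet; exists z.
      have [j _ Sjz] := CA z Cz; exists j => //=.
      by apply: contraPT (Sjz) => nij; move/forall2NP: nz => /(_ j)[].
    - exists (U i) => //; apply: closed_bigcup => //; exact: finite_finset.
  (* Walk along the orbit from [i] to [j], passing from each set to the next at a common point. *)
  suff sub : S j `<=` connected_component A x by apply: sub.
  rewrite -(iter_findex ij); elim: (findex f i j) => [|n IH] /=.
    by apply: connected_component_max => // z Siz; exists i.
  have [z [Sz Sfz]] := S_link (iter n f i).
  rewrite (same_connected_component (IH z Sz)).
  by apply: connected_component_max => // w Sw; exists (f (iter n f i)).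
have S_ne i : S i !=set0 by have [x []] := S_link i; exists x.
have U_inj i j : U i = U j -> fconnect f i j.
  have [x Six] := S_ne i; have : U i x by exists i => //=; apply: connect0.
  move=> + Uij; rewrite Uij => -[k /= jk Skx].
  rewrite (@connect_trans _ _ k) //; last by rewrite f_sym.
  by apply: S_meet; exists x.
have U_root i : U (froot f i) = U i.
  congr bigcup; apply/seteqP; split=> j /=;
    by rewrite -(same_connect f_sym (connect_root (frel f) i)).
(* Orbit roots index the components without repetition. *)
have -> : components A = [set` [fset X in map U (enum (froots f))]%fset].
  apply/seteqP; split=> X /=.
    move=> [x [i _ Six] <-]; rewrite inE (componentE i x) // -U_root.
    by apply: map_f; rewrite mem_enum; apply: roots_root.
  rewrite inE => /mapP[i _ ->]; have [x Six] := S_ne i.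
  by exists x; [exists i | apply: componentE].
rewrite set_fsetK card_fseq undup_id ?size_map -?cardE.
  by apply: eq_card => i; rewrite !inE andbT.
rewrite map_inj_in_uniq ?enum_uniq // => i j; rewrite !mem_enum.
by move=> /eqP ri /eqP rj /U_inj/(fingraph.rootP f_sym); rewrite ri rj.
Qed.

(** * Arcs in space and their intersections *)

Section Curves.
Variable R : realType.
Local Notation space := (R * R * R)%type.

Lemma continuous_line_path (a b : R) : continuous (line_path a b).
Proof.
move=> t; rewrite /line_path; apply: cvgD; apply: cvgMr_tmp => //.
by apply: cvgB => //; apply: cvg_cst.
Qed.

(** A continuous image of [[0, 1]] is connected and compact, hence closed in a Hausdorff space. *)
Lemma curve_connected_closed (x y z : R -> R) :
    continuous x -> continuous y -> continuous z ->
  let C : set space := [set (x t, y t, z t) | t in `[0, 1]] in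
  connected C /\ closed C.
Proof.
move=> x_cont y_cont z_cont C.
have cont : continuous (fun t => (x t, y t, z t) : space).
  by move=> t; exact: (cvg_pair (cvg_pair (x_cont t) (y_cont t)) (z_cont t)).
split.
  apply: connected_continuous_connected; first exact: segment_connected.
  exact: continuous_subspaceT.
apply: compact_closed; first exact: norm_hausdorff.
apply: continuous_compact; first exact: continuous_subspaceT.
exact: segment_compact.
Qed.

Lemma segment_connected_closed (u v : space) :
  connected (segment u v) /\ closed (segment u v).
Proof. by apply: curve_connected_closed => t; apply: continuous_line_path. Qed.

Lemma segment_ends (u v : space) : segment u v u /\ segment u v v.
Proof.
split.
  exists 0; first by rewrite /= in_itv /= lexx ler01.
  by rewrite !line_path0 -!surjective_pairing.
exists 1; first by rewrite /= in_itv /= lexx ler01.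
by rewrite !line_path1 -!surjective_pairing.
Qed.

Lemma polygonal_path_connected_closed (u v : space) (vs : seq space) :
  let P := polygonal_path u (v :: vs) in [/\ connected P, closed P & P u].
Proof.
elim: vs u v => [|v' vs IH] u v /=.
  rewrite setU0; have [conn clos] := segment_connected_closed u v.
  by have [su _] := segment_ends u v; split=> //; left.
have [conn clos Pv] := IH v v'.
have [s_conn s_clos] := segment_connected_closed u v.
have [su sv] := segment_ends u v.
by split; [apply: connectedU => //; exists v | apply: closedU | left].
Qed.

Lemma braid_arc_connected_closed k l i :
  connected (@braid_arc R k l i) /\ closed (@braid_arc R k l i).
Proof.
apply: curve_connected_closed => t; first exact: continuous_line_path.
  apply: cvgMl_tmp; apply: cvgM => //; apply: cvgB => //; exact: cvg_cst.
by apply: cvgD => //; apply: cvg_cst.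
Qed.

Lemma braid_arc_ends k l i : @braid_arc R k l i (i%:R, 0, k%:R) /\
  @braid_arc R k l i ((crossing_target l.1 i)%:R, 0, k.+1%:R).
Proof.
split.
  exists 0 => /=; first by rewrite in_itv /= lexx ler01.
  by rewrite line_path0 mul0r mulr0 addr0.
exists 1 => /=; first by rewrite in_itv /= lexx ler01.
by rewrite line_path1 subrr mulr0 mulr0 natr1.
Qed.

(* A closing arc is the boundary of the rectangle [-i, i] x [-i, L + i] of the
   plane y = 0, without the side of the braid. *)
Lemma closing_arc_coords L i (v : space) : closing_arc L i v ->
  [/\ v.1.2 = 0, - i%:R <= v.1.1 <= i%:R, - i%:R <= v.2 <= L%:R + i%:R &
    [\/ v.1.1 = i%:R /\ (v.2 <= 0 \/ L%:R <= v.2), v.1.1 = - i%:R,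
        v.2 = - i%:R | v.2 = L%:R + i%:R]].
Proof.
have i0 : 0 <= i%:R :> R by []. have L0 : 0 <= L%:R :> R by [].
rewrite /closing_arc /= !natrD; move: i%:R L%:R i0 L0 => a b a0 b0.
(* These bounds let [lra] treat [t * a] and [t * b] as atoms. *)
have scaled t : 0 <= t -> t <= 1 ->
    [/\ 0 <= t * a, t * a <= a, 0 <= t * b & t * b <= b].
  by move=> t0 t1; rewrite !mulr_ge0 ?ler_piMl.
case=> [|[|[|[|[|[]]]]]] [t /=]; rewrite in_itv /= => /andP[t0 t1] <-;
  have [? ? ? ?] := scaled t t0 t1; rewrite /line_path /=;
  (split; [lra | apply/andP; split; lra | apply/andP; split; lra |]).
- by constructor 1; split; [|right]; lra.
- by constructor 4; lra.
- by constructor 2; lra.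
- by constructor 3; lra.
- by constructor 1; split; [|left]; lra.
Qed.

Lemma braid_arc_coords k l i (v : space) : braid_arc k l i v ->
  exists2 t : R, 0 <= t <= 1 &
    v = (line_path i%:R (crossing_target l.1 i)%:R t,
         (-1) ^+ (~~ l.2) * ((crossing_target l.1 i)%:R - i%:R) * (t * (1 - t)),
         k%:R + t).
Proof. by move=> [t /=]; rewrite in_itv /= => t01 <-; exists t. Qed.

(** For [i < j] the rectangle of [i] lies in the interior of that of [j]. *)
Lemma closing_arc_inj L i j (v : space) :
  closing_arc L i v -> closing_arc L j v -> i = j.
Proof.
wlog ij : i j / (i < j)%N => [wl ci cj | ].
  by case: (ltngtP i j) => // ?; [apply: wl | symmetry; apply: wl].
move=> /closing_arc_coords[_ /andP[? ?] /andP[? ?] _].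
move=> /closing_arc_coords[_ _ _].
have ij' : i%:R < j%:R :> R by rewrite ltr_nat.
have i0 : 0 <= i%:R :> R by [].
by case=> [[ex _]|ex|ez|ez]; exfalso; lra.
Qed.

(* The arc through v at height k + t starts at x - t * d, where d is its
   displacement; y is d times the common factor +-t (1 - t), so v determines d
   unless t is 0 or 1. *)
Lemma braid_arc_inj k l i j (v : space) :
  braid_arc k l i v -> braid_arc k l j v -> i = j.
Proof.
move=> /braid_arc_coords[t t01 ->] /braid_arc_coords[u _ [ex ey /addrI eu]].
move: ex ey; rewrite -{}eu {u} => ex ey.
have [t0 | t_neq0] := eqVneq t 0.
  by move: ex; rewrite t0 !line_path0 => /eqP; rewrite eqr_nat => /eqP.
have [t1 | t_neq1] := eqVneq t 1.
  move: ex; rewrite t1 !line_path1 => /eqP; rewrite eqr_nat => /eqP.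
  exact: (can_inj (crossing_targetK l.1)).
have tt : t * (1 - t) != 0 by rewrite mulf_neq0 // subr_eq0 eq_sym.
move: ey => /(mulIf tt)/(can_inj (@signrMK _ _)) ed.
by move: ex; rewrite !line_pathEl ed => /addrI/eqP; rewrite eqr_nat => /eqP.
Qed.

(** The heights force [t = 1] on the lower arc and [u = 0] on the upper one. *)
Lemma braid_arc_succ k k' l l' i j (v : space) : (k < k')%N ->
  braid_arc k l i v -> braid_arc k' l' j v ->
  k' = k.+1 /\ crossing_target l.1 i = j.
Proof.
move=> kk' /braid_arc_coords[t /andP[t0 t1] ->].
move=> /braid_arc_coords[u /andP[u0 u1] [ex _ ez]].
have : k.+1%:R <= k'%:R :> R by rewrite ler_nat.
rewrite -natr1 => le.
have [t_eq1 u_eq0] : t = 1 /\ u = 0 by split; lra.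
move: ex ez; rewrite t_eq1 u_eq0 line_path1 line_path0 natr1 addr0.
by move=> /eqP; rewrite eqr_nat => /eqP -> /eqP; rewrite eqr_nat => /eqP ->.
Qed.

(** A braid arc has [x > 0] and height in [[0, L]], which leaves only the side [x = i] of the
    rectangle, at height [0] or [L], where the arc has an endpoint. *)
Lemma closing_arc_braid_arc L k l i j (v : space) : (k < L)%N -> (0 < i)%N ->
  (0 < j)%N -> (0 < crossing_target l.1 j)%N ->
  closing_arc L i v -> braid_arc k l j v ->
  (k = 0%N /\ j = i) \/ (k.+1 = L /\ crossing_target l.1 j = i).
Proof.
move=> kL i_gt0 j_gt0 j'_gt0 /closing_arc_coords + vb.
have [t /andP[t0 t1] ev] := braid_arc_coords vb.
rewrite {v vb}ev /= => -[_ _ _ e].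
have i0 : 0 < i%:R :> R by rewrite ltr0n.
have k0 : 0 <= k%:R :> R by [].
have kL' : k%:R + 1 <= L%:R :> R by rewrite natr1 ler_nat.
have x0 : 0 < line_path j%:R (crossing_target l.1 j)%:R t :> R.
  have j0 : 1 <= j%:R :> R by rewrite ler1n.
  have j'0 : 1 <= (crossing_target l.1 j)%:R :> R by rewrite ler1n.
  move: j%:R (crossing_target _ _)%:R j0 j'0 => a b a1 b1.
  by rewrite /line_path; nra.
have [ex ez] : line_path j%:R (crossing_target l.1 j)%:R t = i%:R /\
    (k%:R + t <= 0 \/ L%:R <= k%:R + t).
  by case: e => [//|e|e|e]; exfalso; lra.
case: ez => ez.
  have t_eq0 : t = 0 by lra.
  left; split; last by move/eqP: ex; rewrite t_eq0 line_path0 eqr_nat => /eqP.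
  by apply/eqP; rewrite -(@eqr_nat R); apply/eqP; lra.
have t_eq1 : t = 1 by lra.
right; split; last by move/eqP: ex; rewrite t_eq1 line_path1 eqr_nat => /eqP.
by apply/eqP; rewrite -(@eqr_nat R) -natr1; apply/eqP; lra.
Qed.

End Curves.

(** * The loops of a closed braid and how they meet *)

Section ClosedBraidComponents.
Variables (R : realType) (p : nat) (w : braid_word).
Hypothesis w_letters : all (fun l => 0 < l.1 < p)%N w.
Local Notation L := (size w).
Local Notation letter k := (nth (0%N, true) w k).
Local Notation pos k i := (strand_end (take k w) i).

(** Indexed by the bottom position. The top of the strand lies on the closing arc of the loop of
    [strand_end w i]. *)
Definition strand_loop i : set (R * R * R) :=
  closing_arc L i `|` \bigcup_(k in `I_L) braid_arc k (letter k) (pos k i).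

Lemma take_letters k : all (fun l => 0 < l.1 < p)%N (take k w).
Proof.
by move: w_letters; rewrite -{1}(cat_take_drop k w) all_cat => /andP[].
Qed.

Lemma pos_bounds k i : (1 <= i <= p -> 1 <= pos k i <= p)%N.
Proof. exact/strand_end_bounds/take_letters. Qed.

Lemma pos_inj k : injective (fun i => pos k i).
Proof. exact: can_inj (strand_end_inv (take k w)). Qed.

Lemma braid_closure_loops :
  braid_closure p w = \bigcup_(i in [set: 'I_p]) strand_loop i.+1.
Proof.
apply/seteqP; split=> v.
  move=> [i [i_ok [vi | [k kL vk]]]].
    have ip : (i.-1 < p)%N by lia.
    exists (Ordinal ip) => //; left; rewrite /= prednK //; lia.
  (* The strand at position [i] at height [k] is traced back to its bottom position by the inverse
     of the prefix. *)
  have j_ok := strand_end_bounds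
    (@braid_inv_letters (fun j => 0 < j < p)%N _ (take_letters k)) i_ok.
  set j := strand_end _ i in j_ok.
  have jp : (j.-1 < p)%N by lia.
  exists (Ordinal jp) => //; right; exists k => //=.
  by rewrite prednK ?strand_end_invr //; lia.
move=> [i _ [vi | [k /= kL vk]]]; [exists i.+1 | exists (pos k i.+1)].
  by split; [exact: ltn_ord | left].
by split; [exact/pos_bounds/ltn_ord | right; exists k].
Qed.

Lemma strand_loop_connected_closed i :
  connected (strand_loop i) /\ closed (strand_loop i).
Proof.
have [c_conn c_closed _] := polygonal_path_connected_closed
  (i%:R, 0, L%:R) (i%:R, 0, (L + i)%:R)
  [:: (- i%:R, 0, (L + i)%:R); (- i%:R, 0, - i%:R); (i%:R, 0, - i%:R);
      (i%:R : R, 0, 0)].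
split; last first.
  apply: closedU => //; apply: closed_bigcup; first exact: finite_II.
  by move=> k _; have [] := braid_arc_connected_closed R k (letter k) (pos k i).
(* Arcs are added from the bottom up; the invariant keeps the point where the next arc is
   attached. *)
suff ind n : (n <= L)%N ->
    let A : set (R * R * R) := closing_arc L i `|`
      \bigcup_(k in `I_n) braid_arc k (letter k) (pos k i) in
    connected A /\ A ((pos n i)%:R, 0, n%:R).
  by have [] := ind L (leqnn L).
elim: n => [_ | n IH nL] A.
  rewrite /A II0 bigcup_set0 setU0 take0; split=> //.
  do 4 right; left; exact: (segment_ends _ (_, _, _)).2.
have [A_conn An] := IH (ltnW nL).
rewrite /A IIS bigcup_setU bigcup_set1 setUA.
have [arc_conn _] := braid_arc_connected_closed R n (letter n) (pos n i).
have [arc0 arc1] := braid_arc_ends R n (letter n) (pos n i).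
split; last by right; rewrite strand_end_takeS.
by apply: connectedU => //; exists ((pos n i)%:R, 0, n%:R).
Qed.

Lemma strand_loop_next i :
  strand_loop i `&` strand_loop (strand_end w i) !=set0.
Proof.
exists ((strand_end w i)%:R, 0, L%:R); split; last first.
  by left; left; exact: (segment_ends (_, _, _) _).1.
(* For the empty word the common point is on the closing arc; otherwise it is the top of the last
   braid arc. *)
have [L0 | L_gt0] := posnP L.
  by left; rewrite (size0nil L0); left; exact: (segment_ends (_, _, _) _).1.
right; exists L.-1; first by rewrite /= prednK.
have [_] := braid_arc_ends R L.-1 (letter L.-1) (pos L.-1 i).
by rewrite -strand_end_takeS prednK // take_size.
Qed.

Lemma strand_loop_meet i j : (1 <= i <= p)%N -> (1 <= j <= p)%N ->
  strand_loop i `&` strand_loop j !=set0 ->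
  [\/ i = j, strand_end w i = j | strand_end w j = i].
Proof.
have closing_braid a b k (v : R * R * R) :
    (1 <= a <= p)%N -> (1 <= b <= p)%N -> (k < L)%N ->
    closing_arc L a v -> braid_arc k (letter k) (pos k b) v ->
    b = a \/ strand_end w b = a.
  move=> /andP[a_gt0 _] b_ok kL va vb.
  have /andP[b'_gt0 _] := pos_bounds k b_ok.
  have /andP[b''_gt0 _] := pos_bounds k.+1 b_ok.
  rewrite strand_end_takeS // in b''_gt0.
  have [[k0 <-] | [kL' <-]] :=
    closing_arc_braid_arc kL a_gt0 b'_gt0 b''_gt0 va vb.
    by left; rewrite k0 take0.
  by right; rewrite -strand_end_takeS // kL' take_size.
move=> i_ok j_ok [v [[vi | [k /= kL vi]] [vj | [k' /= k'L vj]]]].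
- by constructor 1; apply: closing_arc_inj vi vj.
- have [-> | ->] := closing_braid _ _ _ v i_ok j_ok k'L vi vj.
    by constructor 1.
  by constructor 3.
- have [-> | ->] := closing_braid _ _ _ v j_ok i_ok kL vj vi.
    by constructor 1.
  by constructor 2.
(* Two braid arcs that meet have equal positions at a common height, and [pos] is injective
   there. *)
constructor 1; have [kk' | k'k | kk'] := ltngtP k k'.
- have [e] := braid_arc_succ kk' vi vj.
  by rewrite -strand_end_takeS // -e => /pos_inj.
- have [e] := braid_arc_succ k'k vj vi.
  by rewrite -strand_end_takeS // -e => /pos_inj.
- by rewrite -kk' in vj; have /pos_inj := braid_arc_inj vi vj.
Qed.

Lemma strand_perm_below : perm_below p (fun x => (strand_end w x.+1).-1).
Proof.
split=> [x xp | x y xp yp].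
  by have := strand_end_bounds w_letters (_ : 1 <= x.+1 <= p)%N; lia.
have := strand_end_bounds w_letters (_ : 1 <= x.+1 <= p)%N => /(_ xp) ex.
have := strand_end_bounds w_letters (_ : 1 <= y.+1 <= p)%N => /(_ yp) ey.
move=> e; have : strand_end w x.+1 = strand_end w y.+1 by lia.
by move=> /(can_inj (strand_end_inv w)) [].
Qed.

Lemma card_components_braid_closure :
  #|` fset_set (components (@braid_closure R p w))| =
  ncycles p (fun x => (strand_end w x.+1).-1).
Proof.
have fP := strand_perm_below; set f := fun x => _ in fP *.
have fE (i : 'I_p) : (restr f i).+1 = strand_end w i.+1.
  have := strand_end_bounds w_letters (ltn_ord i : 1 <= i.+1 <= p)%N.
  by rewrite val_restr // => /andP[/prednK].
have fI (i j : 'I_p) : strand_end w i.+1 = j.+1 -> fconnect (restr f) i j.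
  by rewrite -fE => -[/ord_inj <-]; apply: fconnect1.
rewrite braid_closure_loops; apply: components_bigcup.
- exact: restr_inj.
- by move=> i; have [] := strand_loop_connected_closed i.+1.
- by move=> i; have [] := strand_loop_connected_closed i.+1.
- by move=> i; rewrite fE; apply: strand_loop_next.
move=> i j /strand_loop_meet[||[/ord_inj ->]|/fI //|/fI]; rewrite ?ltn_ord //.
by rewrite (fconnect_sym (restr_inj fP)).
Qed.

End ClosedBraidComponents.

(** * From links to cycle counts, and the formula *)

Lemma NC_cycles (R : realType) p q r s :
  (r <= p)%N -> NC R p q r s = strand_cycles p q r s.
Proof.
move=> rp; rewrite /NC card_components_braid_closure; last first.
  exact: twisted_torus_letters.
by apply: eq_ncycles => x _; rewrite strand_end_twisted_torus.
Qed.

Theorem theorem1p1 (R : realType) (p r : nat) (q s : int)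
    (r_gt0 : (0 < r)%N) (r_le_p : (r <= p)%N) :
  exists n : nat,
    [/\ last_index p q r s n,
        forall i : nat, (1 <= i <= n)%N ->
          let: Quad pi qi ri si := quadruple_at p q r s i in
          NC R p q r s = NC R pi qi%:Z ri si%:Z &
        let: Quad pn qn rn sn := quadruple_at p q r s n in
        (qn = 0%N ->
           (NC R p q r s)%:Z = pn%:Z - rn%:Z + (gcdn rn sn)%:Z) /\
        (sn = 0%N -> NC R p q r s = gcdn pn qn)].
Proof.
rewrite /quadruple_at; set a := Quad p _ r _.
have red_a : reduced a.
  have [_ lt_q _] := residueP q (leq_trans r_gt0 r_le_p).
  by have [_ lt_s _] := residueP s r_gt0; apply/and4P.
have NCa : NC R p q r s = cycles_quad a.
  by rewrite (NC_cycles R q s r_le_p); exact/esym/strand_cycles_mod.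
case: (ex_minnP (quadruples_stop red_a)) => m stop_m min_m.
have go i : (i < m)%N -> ~~ stops (iter i next_quadruple a).
  by rewrite ltnNge; apply: contra => /min_m.
(* [m] is the least number of steps leading to a stop, and the sequence is numbered from 1. *)
exists m.+1; split.
- split=> // i /andP[i_gt0 im]; apply: go; rewrite -ltnS prednK //.
- move=> i /andP[i_gt0 im].
  have [|] := @cycles_quad_iter a i.-1 red_a.
    by move=> j ji; apply: go; apply: leq_trans ji _; rewrite -ltnS prednK.
  rewrite NCa; case: (iter _ _ _) => pi qi ri si /and4P[/= ri_gt0 ri_pi _ _] <-.
  by rewrite NC_cycles.
have [red_m] := cycles_quad_iter red_a go.
rewrite NCa /= => <-; have := cycles_quad_stop red_m.
case: (iter _ _ _) red_m => pn qn rn sn /and4P[/= _ rp _ _] [eq_q0 eq_s0].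
(* Truncated subtraction agrees with that of integers since [rn <= pn]. *)
by split=> // /eq_q0 ->; rewrite PoszD subzn.
Qed.
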